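(* Let $G$ be a snark with a normal $5$-edge-coloring $\sigma$, let $C$ be a cycle of length $g$ in $G$, and let $\tilde{G}\in\mathcal{G}_{C}(\mathcal{A},\mathcal{B})$ be a superposition of $G$ along $C$, with superedges $\mathcal{B}_0,\ldots,\mathcal{B}_{g-1}$. If the superedge $\mathcal{B}_{i}$ is dock-right for every $i=0,\ldots,g-1$, then $\tilde{G}$ has a normal $5$-edge-coloring.
   Context: Graphs are simple, cubic and bridgeless. A snark is a bridgeless cubic graph that is not $3$-edge-colorable (no further girth or connectivity condition). Multipoles and normal colorings. A (cubic) multipole consists of vertices, edges (with two end-vertices) and semiedges (with one end-vertex), each vertex being incident to exactly three edges or semiedges. A proper $k$-edge-coloring of a cubic graph or multipole assigns to edges and semiedges colors from $\{1,\ldots,k\}$ so that those incident to the same vertex get distinct colors. For a vertex $v$, $\sigma(v)$ is the set of three colors at $v$. An edge $uv$ is poor (resp. rich) if $|\sigma(u)\cup\sigma(v)|=3$ (resp. $=5$). A normal $5$-edge-coloring is a proper $5$-edge-coloring in which every edge is poor or rich (no requirement on semiedges). A Kempe $(a,b)$-chain is a path that starts and ends with a semiedge and whose (semi)edges are alternately colored $a$ and $b$. Color schemes. If $s$ is a semiedge with end-vertex $v$, its color scheme is $\sigma[s]=(a,\{b,c\})$, where $a=\sigma(s)$ and $b,c$ are the two other colors at $v$. Schemes $(a,\{b,c\})$ and $(a',\{b',c'\})$ are consistent if $a=a'$ and $\{b,c\}$ equals $\{b',c'\}$ or $\{1,2,3,4,5\}\setminus\{a',b',c'\}$. Superedges.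 For a snark $H$ and distinct nonadjacent vertices $x,y$ of $H$, $H_{x,y}$ is the multipole obtained from $H$ by deleting $x$ and $y$ and turning each edge incident to $x$ or $y$ into a semiedge at its remaining end-vertex. The three semiedges coming from $x$ form the left connector and are labelled $s_1^l,s_2^l,s_3^l$; the three coming from $y$ form the right connector and are labelled $s_1^r,s_2^r,s_3^r$. Superpositions. Let $C=u_0u_1\cdots u_{g-1}u_0$ be a cycle in $G$ (indices modulo $g$), let $v_i$ be the neighbor of $u_i$ other than $u_{i-1},u_{i+1}$, and $f_i=u_iv_i$. A superposition $\tilde G\in\mathcal{G}_C(\mathcal{A},\mathcal{B})$ is any cubic graph obtained from the following data, for each $i=0,\ldots,g-1$: a superedge $\mathcal{B}_i=H_{x,y}$ ($H$ a snark, $x,y$ distinct nonadjacent vertices of $H$, all possibly depending on $i$), a supervertex type $\mathcal{A}_i\in\{A,A'\}$, a permutation $p_i$ of $\{1,2,3\}$ and a dock index $d_i\in\{1,2,3\}$. It is constructed as follows: delete from $G$ the edges of $C$ (keeping the vertices $u_i$, the edges $f_i$ and the rest of $G$) and add disjoint copies of $\mathcal{B}_0,\ldots,\mathcal{B}_{g-1}$; for each $i$ and each $j\in\{1,2,3\}$, join the right semiedge $s^r_{p_{i-1}^{-1}(j)}$ of $\mathcal{B}_{i-1}$ with the left semiedge $s^l_j$ of $\mathcal{B}_i$ into one edge; subdivide the edge obtained for $j=d_i$ by the vertex $u_i$ (so $u_i$ has degree 3, its third edge being $f_i$). If $\mathcal{A}_i=A$ nothing more is done at $i$. If $\mathcal{A}_i=A'$,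 each of the two edges obtained for $j\neq d_i$ is subdivided by one new vertex, and these two new vertices are joined by an edge. Right superedges. A superedge $\mathcal{B}_i$ is $j$-right ($j\in\{1,2,3\}$) if it has a normal $5$-edge-coloring such that: the color schemes of $s_j^l$ and of all three right semiedges are consistent with $(3,\{1,2\})$; the color schemes of the two left semiedges other than $s_j^l$ are consistent with $(2,\{1,3\})$; and there is a Kempe $(2,1)$-chain connecting these two left semiedges. $\mathcal{B}_i$ is dock-right if it is $j$-right for $j=d_i$. *)

(* Defs.v *)
From mathcomp Require Import all_boot fingroup perm.

Set Implicit Arguments.
Unset Strict Implicit.
Unset Printing Implicit Defensive.

Record sgraph := SGraph {
  vert :> finType;
  adj : rel vert;
  adj_sym : symmetric adj;
  adj_irr : irreflexive adj
}.

(* Neither structure is assumed cubic here: see [cubic] below. All multipoles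
   that occur have a simple underlying graph. *)
Record multipole := Multipole {
  mgraph :> sgraph;
  semi : finType;
  send : semi -> mgraph      (* the unique end-vertex of a semiedge *)
}.

Definition graph_multipole (G : sgraph) : multipole :=
  @Multipole G void (of_void G).

(* The edges and semiedges at v: [inl w] stands for the edge vw, [inr s] for
   the semiedge s. *)
Definition incident (M : multipole) (v : M) : pred (M + semi M) :=
  fun h => match h with inl w => adj v w | inr s => send s == v end.

Definition cubic (M : multipole) : Prop := forall v : M, #|incident v| = 3.

Definition edge_deleted (G : sgraph) (u v : G) : rel G :=
  fun a b => adj a b && ([set a; b] != [set u; v]).

Definition bridgeless (G : sgraph) : Prop :=
  forall u v : G, adj u v -> connect (edge_deleted u v) u v.

(* [ecol c u v] is the colour of the edge uv; its value is irrelevant when u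
   and v are not adjacent. *)
Record coloring (k : nat) (M : multipole) := Coloring {
  ecol : M -> M -> 'I_k;
  scol : semi M -> 'I_k;
  ecol_sym : forall u v, ecol u v = ecol v u
}.

Definition hcol k (M : multipole) (c : coloring k M) (v : M)
  (h : M + semi M) : 'I_k :=
  match h with inl w => ecol c v w | inr s => scol c s end.

Definition proper_coloring k (M : multipole) (c : coloring k M) : Prop :=
  forall v : M, {in incident v &, injective (hcol c v)}.

Definition colors_at k (M : multipole) (c : coloring k M) (v : M) :
  {set 'I_k} := [set hcol c v h | h in incident v].

Definition poor k (M : multipole) (c : coloring k M) (u v : M) : bool :=
  #|colors_at c u :|: colors_at c v| == 3.

Definition rich k (M : multipole) (c : coloring k M) (u v : M) : bool :=
  #|colors_at c u :|: colors_at c v| == 5.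

Definition normal_coloring (M : multipole) (c : coloring 5 M) : Prop :=
  proper_coloring c /\ (forall u v : M, adj u v -> poor c u v || rich c u v).

Definition snark (H : sgraph) : Prop :=
  [/\ cubic (graph_multipole H), bridgeless H
    & ~ exists c : coloring 3 (graph_multipole H), proper_coloring c].

(* The colours 1, 2, 3 of {1, ..., 5}; the ordinal i encodes the colour i+1. *)
Definition col1 : 'I_5 := @Ordinal 5 0 isT.
Definition col2 : 'I_5 := @Ordinal 5 1 isT.
Definition col3 : 'I_5 := @Ordinal 5 2 isT.

Definition scheme (M : multipole) (c : coloring 5 M) (s : semi M) :
  'I_5 * {set 'I_5} := (scol c s, colors_at c (send s) :\ scol c s).

Definition consistent (x y : 'I_5 * {set 'I_5}) : bool :=
  (x.1 == y.1) && ((x.2 == y.2) || (x.2 == ~: (y.1 |: y.2))).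

Definition alternating k (a b : 'I_k) (l : seq 'I_k) : bool :=
  all (pred2 a b) l && sorted (fun x y => x != y) l.

(* The vertices of the chain are [send s :: q]. *)
Definition kempe_chain k (M : multipole) (c : coloring k M) (a b : 'I_k)
  (s t : semi M) : Prop :=
  exists q : seq M,
    [/\ path (@adj M) (send s) q, last (send s) q = send t,
        uniq (send s :: q)
      & alternating a b
          (scol c s :: rcons (pairmap (ecol c) (send s) q) (scol c t))].

(* [nbx] and [nby] number the three edges at x and at y: since H is cubic,
   each is a bijection from 'I_3 onto the neighbours of x, resp. y. The index
   j of {1, 2, 3} is encoded by the ordinal j-1. *)
Record superedge := Superedge {
  seH : sgraph;
  seH_snark : snark seH;
  sex : seH;
  sey : seH;
  sex_neq : sex != sey;
  sex_nadj : ~~ adj sex sey;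
  nbx : 'I_3 -> seH;
  nbx_inj : injective nbx;
  nbx_adj : forall j, adj sex (nbx j);
  nby : 'I_3 -> seH;
  nby_inj : injective nby;
  nby_adj : forall j, adj sey (nby j)
}.

Definition kept (B : superedge) : pred (seH B) :=
  fun v => (v != sex B) && (v != sey B).

Lemma nbx_kept (B : superedge) (j : 'I_3) : kept (nbx B j).
Proof.
have h := nbx_adj B j; apply/andP; split; apply/eqP => e; rewrite e in h.
  by rewrite adj_irr in h.
by rewrite (negbTE (sex_nadj B)) in h.
Qed.

Lemma nby_kept (B : superedge) (j : 'I_3) : kept (nby B j).
Proof.
have h := nby_adj B j; apply/andP; split; apply/eqP => e; rewrite e in h.
  by rewrite adj_sym (negbTE (sex_nadj B)) in h.
by rewrite adj_irr in h.
Qed.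

Definition kept_vert (B : superedge) : finType := {v : seH B | kept v}.

Definition kept_adj (B : superedge) : rel (kept_vert B) :=
  fun u v => adj (val u) (val v).

Lemma kept_adj_sym (B : superedge) : symmetric (@kept_adj B).
Proof. by move=> u v; exact: adj_sym. Qed.

Lemma kept_adj_irr (B : superedge) : irreflexive (@kept_adj B).
Proof. by move=> u; exact: adj_irr. Qed.

Definition kept_graph (B : superedge) : sgraph :=
  SGraph (@kept_adj_sym B) (@kept_adj_irr B).

Definition lend (B : superedge) (j : 'I_3) : kept_graph B :=
  exist _ (nbx B j) (nbx_kept B j).

Definition rend (B : superedge) (j : 'I_3) : kept_graph B :=
  exist _ (nby B j) (nby_kept B j).

(* H_{x,y}: [inl j] is the left semiedge with label j, [inr j] the right one. *)
Definition se_multipole (B : superedge) : multipole :=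
  @Multipole (kept_graph B) ('I_3 + 'I_3)%type
    (fun s => match s with inl j => lend B j | inr j => rend B j end).

Definition sl (B : superedge) (j : 'I_3) : semi (se_multipole B) := inl j.
Definition sr (B : superedge) (j : 'I_3) : semi (se_multipole B) := inr j.

Definition right_superedge (B : superedge) (j : 'I_3) : Prop :=
  exists c : coloring 5 (se_multipole B),
    [/\ normal_coloring c,
        consistent (scheme c (sl B j)) (col3, [set col1; col2]),
        forall k, consistent (scheme c (sr B k)) (col3, [set col1; col2]),
        forall k, k != j ->
          consistent (scheme c (sl B k)) (col2, [set col1; col3])
      & forall k l, k != j -> l != j -> k != l ->
          kempe_chain c col2 col1 (sl B k) (sl B l)].

(* The cycle u_0 u_1 ... u_(g-1) u_0; [ordS] and [ord_pred] are successor and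
   predecessor modulo g. *)
Record cycle_in (G : sgraph) (g : nat) := CycleIn {
  cyc :> 'I_g -> G;
  cyc_size : 2 < g;
  cyc_inj : injective cyc;
  cyc_adj : forall i, adj (cyc i) (cyc (ordS i))
}.

Definition cycle_edge (G : sgraph) g (C : cycle_in G g) : rel G :=
  fun u v => [exists i, [set u; v] == [set C i; C (ordS i)]].

Variant supervertex := SvA | SvA'.

Definition is_SvA' (a : supervertex) : bool :=
  match a with SvA => false | SvA' => true end.

(* The data (B_i, A_i, p_i, d_i); p_i sends the labels of the right semiedges of
   B_i to those of the left semiedges of B_(i+1). *)
Record sp_data (g : nat) := SpData {
  spB : 'I_g -> superedge;
  spA : 'I_g -> supervertex;
  spp : 'I_g -> 'S_3;
  dock : 'I_g -> 'I_3
}.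

Definition new_index g (S : sp_data g) : pred ('I_g * 'I_3) :=
  fun n => is_SvA' (spA S n.1) && (n.2 != dock S n.1).

Definition old_vert (G : sgraph) : finType := G.

Definition sup_vert g (S : sp_data g) : finType :=
  {i : 'I_g & kept_graph (spB S i)}.

(* The vertex (i, j) subdivides the edge obtained for the index j at u_i. *)
Definition new_vert g (S : sp_data g) : finType :=
  {n : 'I_g * 'I_3 | new_index S n}.

Definition left_end g (S : sp_data g) (i : 'I_g) (j : 'I_3) : sup_vert S :=
  Tagged (fun i => kept_graph (spB S i)) (lend (spB S i) j).

Definition right_end g (S : sp_data g) (i : 'I_g) (j : 'I_3) : sup_vert S :=
  Tagged (fun i => kept_graph (spB S i)) (rend (spB S i) j).

(* The end, in the superedge preceding u_i, of the right semiedge that is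
   joined with the left semiedge j of the superedge following u_i. *)
Definition prev_end g (S : sp_data g) (i : 'I_g) (j : 'I_3) : sup_vert S :=
  right_end S (ord_pred i) ((spp S (ord_pred i))^-1%g j).

(* Joined semiedges whose common edge is not subdivided. *)
Definition plain_link g (S : sp_data g) : rel (sup_vert S) :=
  fun a b => [exists i, exists j,
    [&& j != dock S i, ~~ is_SvA' (spA S i),
        a == prev_end S i j & b == left_end S i j]].

Definition sup_adj g (S : sp_data g) : rel (sup_vert S) :=
  fun a b => ((tag a == tag b) && adj (tagged a) (tagged_as a b))
             || plain_link a b || plain_link b a.

Definition dock_adj (G : sgraph) g (C : cycle_in G g) (S : sp_data g)
  (u : G) (a : sup_vert S) : bool :=
  [exists i, (u == C i) &&
    ((a == prev_end S i (dock S i)) || (a == left_end S i (dock S i)))].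

Definition new_adj g (S : sp_data g) (n : new_vert S) (a : sup_vert S) :
  bool :=
  let: (i, j) := val n in (a == prev_end S i j) || (a == left_end S i j).

Definition sp_vert (G : sgraph) g (S : sp_data g) : finType :=
  (old_vert G + sup_vert S + new_vert S)%type.

Definition sp_adj (G : sgraph) g (C : cycle_in G g) (S : sp_data g) :
  rel (sp_vert G S) :=
  fun a b => match a, b with
  | inl (inl u), inl (inl v) => adj u v && ~~ cycle_edge C u v
  | inl (inr x), inl (inr y) => sup_adj x y
  | inr m, inr n => ((val m).1 == (val n).1) && (m != n)
  | inl (inl u), inl (inr x) | inl (inr x), inl (inl u) => dock_adj C u x
  | inr n, inl (inr x) | inl (inr x), inr n => new_adj n x
  | inl (inl _), inr _ | inr _, inl (inl _) => false
  end.

Lemma cycle_edge_sym (G : sgraph) g (C : cycle_in G g) :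
  symmetric (cycle_edge C).
Proof. by move=> u v; rewrite /cycle_edge setUC. Qed.

Lemma sp_adj_sym (G : sgraph) g (C : cycle_in G g) (S : sp_data g) :
  symmetric (sp_adj C (S := S)).
Proof.
move=> [[u|x]|m] [[v|y]|n] //=.
- by rewrite adj_sym cycle_edge_sym.
- rewrite /sup_adj -!orbA; congr orb; last by rewrite orbC.
  case: x y => [i x] [j y] /=; case: (eqVneq i j) => [e|/negbTE ne] /=.
    by subst j; rewrite !tagged_asE /=; exact: kept_adj_sym.
  by [].
- by rewrite eq_sym [m == n]eq_sym.
Qed.

Lemma ord_pred_neq g (i : 'I_g) : 1 < g -> ord_pred i != i.
Proof.
move=> g1; apply/eqP => /(congr1 (@ordS g)); rewrite ord_predK => /(congr1 val).
move=> /= e; have := ltn_ord i; rewrite leq_eqVlt => /orP[/eqP e'|lt].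
  move: e; rewrite e' modnn => i0; by rewrite -e' i0 in g1.
by move: e; rewrite modn_small // => /eqP; rewrite eqn_leq ltnn andbF.
Qed.

Lemma sp_adj_irr (G : sgraph) g (C : cycle_in G g) (S : sp_data g) :
  irreflexive (sp_adj C (S := S)).
Proof.
move=> [[u|x]|m] /=; first by rewrite adj_irr.
- rewrite /sup_adj eqxx -orbA orbb.
  have -> : tagged_as x x = tagged x by case: x => i x; rewrite tagged_asE.
  rewrite adj_irr /=; apply/existsP => -[i /existsP[j]].
  case/and4P=> _ _ /eqP-> /eqP/(congr1 tag) /= /eqP.
  by rewrite (negbTE (ord_pred_neq _ (ltnW (cyc_size C)))).
- by rewrite !eqxx.
Qed.

Definition superposition (G : sgraph) g (C : cycle_in G g) (S : sp_data g) :
  sgraph := SGraph (sp_adj_sym C (S := S)) (sp_adj_irr C (S := S)).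

Definition dock_right g (S : sp_data g) (i : 'I_g) : Prop :=
  right_superedge (spB S i) (dock S i).

(* Main.v *)
Require Import Defs.
From mathcomp Require Import all_boot fingroup perm.

Set Implicit Arguments.
Unset Strict Implicit.
Unset Printing Implicit Defensive.

(** Write e_i for the color of the cycle edge u_i u_(i+1) under sigma, f_i for
the color of the third edge u_i v_i, and T_i = {e_(i-1), f_i, e_i} for the
colors at u_i. The old part of G keeps its colors, the three right semiedges of
B_i all get the color e_i, and the dock semiedge on the left of B_i gets e_i
too, so that u_i still sees exactly T_i.

The colors are renamed in the given right coloring of B_i: 1 becomes f_i, 2
becomes e_(i-1) and 3 becomes e_i. Then the two remaining left semiedges have
the color e_(i-1) of the right semiedges of B_(i-1), and can be joined with
them. If A_i = A', an edge colored e_i joins the vertices subdividing these two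
edges, so their left semiedges have to be colored f_i instead; the Kempe chain
of the hypothesis is there to make this exchange. All its vertices see both
colors of the chain, so that exchanging the colors changes no color set
([kempe_swap_chain]) and the coloring stays normal
([right_superedge_coloring]).

Normality is read off the color sets at the two ends of an edge of color a: they
must be equal or meet exactly in a. For sets of three colors out of five that
contain a this is an equivalence relation, [aligned a]. It is what consistency
of color schemes becomes once a scheme is replaced by the full color set. On
the edge u_(i-1) u_i of G it says that T_(i-1) and T_i are aligned
([cycle_colors_aligned]). Hence on every new edge at u_i, both ends are aligned
with T_i, and thus with each other ([normal_at_sup]).

That the coloring is proper and has the expected color sets is checked vertex
by vertex, by comparison with a vertex of a colored multipole that sees the
same colors: in B_i for the vertices of B_i, and u_i in G for u_i and for the
vertices subdividing the links ([local_recoloring]). *)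

(** * Color sets at the two ends of an edge *)

(** For sets X, Y of three colors out of five with a in both, the second case
says that X and Y meet in a alone: the edge of color a between them is rich. *)
Definition aligned (T : finType) (a : T) (X Y : {set T}) : bool :=
  (X == Y) || (X == a |: ~: Y).

Lemma aligned_refl (T : finType) (a : T) (X : {set T}) : aligned a X X.
Proof. by rewrite /aligned eqxx. Qed.

Lemma aligned_sym (T : finType) (a : T) (X Y : {set T}) :
  a \in Y -> aligned a X Y -> aligned a Y X.
Proof.
move=> aY /orP[/eqP->|/eqP->]; first exact: aligned_refl.
apply/orP; right; apply/eqP/setP=> x; rewrite !inE negb_or negbK.
by case: eqVneq => // ->.
Qed.

(** Only Y and a |: ~: Y are aligned with Y, so X and Z coincide if both differ
from Y. *)
Lemma aligned_trans (T : finType) (a : T) (X Y Z : {set T}) :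
  a \in Z -> aligned a X Y -> aligned a Y Z -> aligned a X Z.
Proof.
move=> aZ /orP[/eqP->//|/eqP->] /orP[/eqP->|/eqP->].
  by rewrite /aligned eqxx orbT.
apply/orP; left; apply/eqP/setP=> x; rewrite !inE negb_or negbK.
by case: eqVneq => // ->.
Qed.

Lemma aligned_perm (T : finType) (p : {perm T}) (a : T) (X Y : {set T}) :
  aligned a X Y -> aligned (p a) (p @: X) (p @: Y).
Proof.
move=> /orP[/eqP->|/eqP->]; first exact: aligned_refl.
apply/orP; right; rewrite imsetU1; apply/eqP; congr (_ |: _).
by rewrite -!preim_permV preimsetC.
Qed.

Lemma card_aligned (a : 'I_5) (X Y : {set 'I_5}) :
  #|Y| = 3 -> a \in Y -> aligned a X Y -> #|X| = 3.
Proof.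
move=> cY aY /orP[/eqP->//|/eqP->].
by rewrite cardsU1 !inE aY cardsCs setCK cY card_ord.
Qed.

Definition normal_sets (T : finType) (X Y : {set T}) : bool :=
  (#|X :|: Y| == 3) || (#|X :|: Y| == 5).

Lemma aligned_normal_sets (a : 'I_5) (X Y : {set 'I_5}) :
  #|Y| = 3 -> a \in Y -> aligned a X Y -> normal_sets X Y.
Proof.
rewrite /normal_sets => cY aY /orP[/eqP->|/eqP->]; first by rewrite setUid cY.
have -> : (a |: ~: Y) :|: Y = setT.
  by apply/setP=> x; rewrite !inE -orbA orNb orbT.
by rewrite cardsT card_ord orbT.
Qed.

Lemma common_aligned_normal_sets (a : 'I_5) (X Y Z : {set 'I_5}) :
    #|Z| = 3 -> a \in Z -> aligned a X Z -> aligned a Y Z ->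
  normal_sets X Y.
Proof.
move=> cZ aZ XZ YZ; have ZY := aligned_sym aZ YZ.
have aY : a \in Y by move: YZ => /orP[/eqP->//|/eqP->]; rewrite !inE eqxx.
apply: (aligned_normal_sets (card_aligned cZ aZ YZ) aY).
exact: (aligned_trans aY XZ ZY).
Qed.

(** A union of size 5 forces an intersection of size 3 + 3 - 5 = 1, which has
to be the common color a. *)
Lemma normal_sets_aligned (a : 'I_5) (X Y : {set 'I_5}) :
    #|X| = 3 -> #|Y| = 3 -> a \in X -> a \in Y ->
  normal_sets X Y -> aligned a X Y.
Proof.
move=> cX cY aX aY /orP[/eqP cU|/eqP cU]; apply/orP; [left|right].
  have /eqP eX : X == X :|: Y by rewrite eqEcard subsetUl cX cU.
  have /eqP eY : Y == X :|: Y by rewrite eqEcard subsetUr cY cU.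
  by rewrite eX -eY.
have cI : #|X :&: Y| = 1.
  by apply/eqP; rewrite -(eqn_add2l #|X :|: Y|) cardsUI cX cY cU.
have eI : X :&: Y = [set a].
  by apply/esym/eqP; rewrite eqEcard sub1set inE aX aY cards1 cI.
have eU : X :|: Y = setT by apply/eqP; rewrite eqEcard subsetT cardsT card_ord cU.
apply/eqP/setP=> x; move/setP/(_ x): eI; move/setP/(_ x): eU; rewrite !inE.
by case: (x \in X); case: (x \in Y); case: (x == a).
Qed.

Lemma normal_setsC (T : finType) (X Y : {set T}) :
  normal_sets X Y = normal_sets Y X.
Proof. by rewrite /normal_sets setUC. Qed.

(** * Recoloring multipoles *)

Lemma mem_hcol k (M : multipole) (c : coloring k M) (v : M) h :
  incident v h -> hcol c v h \in colors_at c v.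
Proof. by move=> vh; apply: imset_f. Qed.

Lemma scol_colors_at k (M : multipole) (c : coloring k M) (s : semi M) :
  scol c s \in colors_at c (send s).
Proof. by apply: (@mem_hcol _ _ c (send s) (inr s)) => /=. Qed.

Lemma card_colors_at k (M : multipole) (c : coloring k M) (v : M) :
  cubic M -> proper_coloring c -> #|colors_at c v| = 3.
Proof. by move=> cubM propc; rewrite card_in_imset //; apply: cubM. Qed.

Section PermuteColors.
Variables (k : nat) (M : multipole) (c : coloring k M) (p : {perm 'I_k}).

Definition permute_colors : coloring k M :=
  @Coloring k M (fun u v => p (ecol c u v)) (fun s => p (scol c s))
    (fun u v => congr1 p (ecol_sym c u v)).

Lemma hcol_permute v h : hcol permute_colors v h = p (hcol c v h).
Proof. by case: h. Qed.

Lemma colors_at_permute v : colors_at permute_colors v = p @: colors_at c v.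
Proof. by rewrite -imset_comp; apply: eq_imset => h; rewrite hcol_permute. Qed.

Lemma proper_permute : proper_coloring c -> proper_coloring permute_colors.
Proof.
move=> propc v h1 h2 vh1 vh2; rewrite !hcol_permute => /perm_inj.
exact: propc.
Qed.

End PermuteColors.

Lemma normal_permute (M : multipole) (c : coloring 5 M) (p : {perm 'I_5}) :
  normal_coloring c -> normal_coloring (permute_colors c p).
Proof.
move=> [propc nc]; split; first exact: proper_permute.
move=> u v /nc; rewrite /poor /rich !colors_at_permute -imsetU.
by rewrite card_imset //; apply: perm_inj.
Qed.

(** * Kempe swaps *)

Section KempeSwap.
Variables (k : nat) (M : multipole) (c : coloring k M) (a b : 'I_k).

Section Swap.
Variable P : {set M}.

Definition within (h : M + semi M) : bool :=
  if h is inl w then w \in P else true.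

(** Both a and b occur at v, on semiedges or on edges that stay in P. By
properness no edge of color a or b at v then leaves P, so P is closed in the
subgraph of the colors a and b and the swap on P is consistent. *)
Definition both_within (v : M) : Prop :=
  forall x, pred2 a b x ->
    exists h, [/\ incident v h, hcol c v h = x & within h].

Lemma both_withinP (v : M) h1 h2 :
    incident v h1 -> within h1 -> pred2 a b (hcol c v h1) ->
    incident v h2 -> within h2 -> pred2 a b (hcol c v h2) ->
  hcol c v h1 != hcol c v h2 -> both_within v.
Proof.
move=> i1 w1 p1 i2 w2 p2 ne x px.
have [e|e] := eqVneq (hcol c v h1) x; first by exists h1.
exists h2; split=> //; move: p1 p2 px ne e => /=.
by do 3![case/orP=> /eqP->]; rewrite ?eqxx.
Qed.

(** Each vertex of a chain is entered by one of the two colors and left by the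
other. The induction carries the half-edge h by which x is entered: the
semiedge at the start of the chain, later an edge of the path. *)
Lemma chain_both_within (t : semi M) (q : seq M) (x : M) (h : M + semi M) :
    path (@adj M) x q -> last x q = send t ->
    alternating a b (hcol c x h :: rcons (pairmap (ecol c) x q) (scol c t)) ->
    incident x h -> within h -> {subset x :: q <= P} ->
  {in x :: q, forall v, both_within v}.
Proof.
elim: q x h => [|y q IH] x h /=.
  move=> _ xt; rewrite /alternating /= !andbT => /andP[/andP[p1 p2] ne] ih wh _ v.
  rewrite inE => /eqP->; apply: (both_withinP (h2 := inr t) ih wh p1 _ _ p2 ne) => //=.
  by rewrite xt.
case/andP=> xy pq lq; rewrite /alternating /=.
case/andP=> /and3P[p1 p2 al] /andP[ne so] ih wh sub v; rewrite inE => /orP[/eqP->|].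
  apply: (both_withinP (h2 := inl y) ih wh p1 _ _ p2 ne) => //=.
  by apply: sub; rewrite !inE eqxx orbT.
apply: (IH y (inl x)) => //=.
- by rewrite /alternating /= ecol_sym p2 al so.
- by rewrite adj_sym.
- by apply: sub; rewrite inE eqxx.
- by move=> z zq; apply: sub; rewrite inE zq orbT.
Qed.

Definition swapped_ecol (u v : M) : 'I_k :=
  if (u \in P) && (v \in P) then tperm a b (ecol c u v) else ecol c u v.

Lemma swapped_ecol_sym u v : swapped_ecol u v = swapped_ecol v u.
Proof. by rewrite /swapped_ecol andbC ecol_sym. Qed.

Definition kempe_swap : coloring k M :=
  @Coloring k M swapped_ecol
    (fun s => if send s \in P then tperm a b (scol c s) else scol c s)
    swapped_ecol_sym.

Hypotheses (propc : proper_coloring c) (PP : {in P, forall v, both_within v}).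

Lemma leaving_edge_fixed (v w : M) :
  v \in P -> w \notin P -> adj v w -> tperm a b (ecol c v w) = ecol c v w.
Proof.
move=> vP wP vw.
have stays x : pred2 a b x -> x != ecol c v w.
  move=> px; apply: contraNneq wP => e; have [h [vh hE hw]] := PP vP px.
  have eh : h = inl w by apply: (@propc v h (inl w) vh vw); rewrite hE.
  by rewrite eh in hw.
by apply: tpermD; apply: stays; rewrite /= eqxx ?orbT.
Qed.

Lemma hcol_kempe_swap v h : incident v h ->
  hcol kempe_swap v h =
    if v \in P then tperm a b (hcol c v h) else hcol c v h.
Proof.
case: h => [w|s] /=; last by move/eqP->.
rewrite /swapped_ecol => vw; case: (boolP (v \in P)) => //= vP.
by case: (boolP (w \in P)) => // wP; rewrite leaving_edge_fixed.
Qed.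

Lemma proper_kempe_swap : proper_coloring kempe_swap.
Proof.
move=> v h1 h2 i1 i2; rewrite !hcol_kempe_swap //.
by case: ifP => _ => [/perm_inj|]; apply: propc.
Qed.

(** A vertex of P sees both a and b, so its color set is invariant under the
transposition. *)
Lemma colors_at_kempe_swap v : colors_at kempe_swap v = colors_at c v.
Proof.
have -> : colors_at kempe_swap v =
    (if v \in P then tperm a b else 1%g) @: colors_at c v.
  rewrite /colors_at -imset_comp; apply: eq_in_imset => h vh /=.
  by rewrite hcol_kempe_swap //; case: ifP => _ //; rewrite perm1.
case: ifP => [vP|_]; last first.
  by rewrite -[RHS]imset_id; apply: eq_imset => x; rewrite perm1.
have ab x : pred2 a b x -> x \in colors_at c v.
  by move/(PP vP) => [h [vh <- _]]; apply: mem_hcol.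
have aX : a \in colors_at c v by apply: ab; rewrite /= eqxx.
have bX : b \in colors_at c v by apply: ab; rewrite /= eqxx orbT.
apply/eqP; rewrite eqEcard (card_imset _ perm_inj) leqnn andbT.
by apply/subsetP=> _ /imsetP[x xX ->]; case: tpermP => // ->.
Qed.

End Swap.

Lemma kempe_swap_chain (s t : semi M) :
    proper_coloring c -> kempe_chain c a b s t ->
  exists c' : coloring k M,
    [/\ proper_coloring c', forall v, colors_at c' v = colors_at c v,
        scol c' s = tperm a b (scol c s), scol c' t = tperm a b (scol c t)
      & forall r, ~~ pred2 a b (scol c r) -> scol c' r = scol c r].
Proof.
move=> propc [q [pq lq _ al]].
pose P := [set v in send s :: q].
have PP : {in P, forall v, both_within P v}.
  move=> v; rewrite inE => vq.
  apply: (chain_both_within (h := inr s) pq lq al) vq => //=.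
  by move=> z zq; rewrite inE.
have sP : send s \in P by rewrite inE mem_head.
have tP : send t \in P by rewrite inE -lq mem_last.
exists (kempe_swap P); split.
- exact: (proper_kempe_swap propc PP).
- by move=> v; apply: (colors_at_kempe_swap propc PP).
- by rewrite /= sP.
- by rewrite /= tP.
- move=> r; rewrite negb_or /= => /andP[ra rb]; case: ifP => // _.
  by rewrite tpermD // eq_sym.
Qed.

(** At the first vertex this excludes one of the two cases of consistency: a
color set without one of the two colors of the chain. *)
Lemma kempe_chain_colors_at (s t : semi M) (x : 'I_k) :
  kempe_chain c a b s t -> pred2 a b x -> x \in colors_at c (send s).
Proof.
move=> [q [pq lq _ al]] px.
have bw : {in send s :: q, forall v, both_within setT v}.
  by apply: (chain_both_within (h := inr s) pq lq al) => //= z _; rewrite inE.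
have [h [ih <- _]] := bw _ (mem_head _ _) x px.
exact: mem_hcol.
Qed.

End KempeSwap.

(** * Superedges adapted to a vertex of the cycle *)

Lemma perm_extending (T : finType) (s t : seq T) :
  size s = size t -> uniq s -> uniq t -> exists p : {perm T}, map p s = t.
Proof.
elim: s t => [|x s IH] [|y t] //=; first by exists 1%g.
case=> st /andP[xs us] /andP[yt ut]; have [p pst] := IH t st us ut.
exists (p * tperm (p x) y)%g; rewrite permM tpermL; congr (_ :: _).
rewrite -[RHS]pst; apply/eq_in_map => z zs; rewrite permM tpermD //.
- by rewrite (inj_eq perm_inj); apply: contraNneq xs => ->.
- by apply: contraNneq yt => ->; rewrite -pst map_f.
Qed.

Lemma other_two (j : 'I_3) :
  exists k l, [/\ k != j, l != j, k != l & forall m, m != j -> m = k \/ m = l].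
Proof.
pose o i (lti : i < 3) := Ordinal lti.
by case: j => [[|[|[|//]]] lj];
  [exists (o 1 isT), (o 2 isT)|exists (o 0 isT), (o 2 isT)
  |exists (o 0 isT), (o 1 isT)];
  split=> // -[[|[|[|//]]] lm] // _;
  (try by left; apply: val_inj); (try by right; apply: val_inj).
Qed.

(** Consistency of color schemes, expressed by the full color set X = a |: {b,
c} in place of the scheme (a, {b, c}). *)
Definition matches (M : multipole) (c : coloring 5 M) (s : semi M)
  (a : 'I_5) (X : {set 'I_5}) : Prop :=
  scol c s = a /\ aligned a (colors_at c (send s)) X.

Lemma consistent_matches (M : multipole) (c : coloring 5 M) (s : semi M) a U X :
  a |: U = X -> consistent (scheme c s) (a, U) -> matches c s a X.
Proof.
move=> <- /andP[/eqP /= sa]; rewrite sa => eU; split=> //.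
have aX : a \in colors_at c (send s) by rewrite -sa scol_colors_at.
rewrite -(setD1K aX); apply/orP.
by case/orP: eU => /eqP->; [left|right].
Qed.

Lemma matches_permute (M : multipole) (c : coloring 5 M) (p : {perm 'I_5})
    (s : semi M) a X :
  matches c s a X -> matches (permute_colors c p) s (p a) (p @: X).
Proof.
move=> [sa al]; split; first by rewrite /= sa.
by rewrite colors_at_permute; apply: aligned_perm.
Qed.

(** The colorings of a superedge that fit behind a vertex whose color set is X
and whose next cycle edge has color b; b' is the color that the two left
semiedges other than the dock have to carry. *)
Definition adapted (B : superedge) (j : 'I_3) (c : coloring 5 (se_multipole B))
  (b' b : 'I_5) (X : {set 'I_5}) : Prop :=
  [/\ normal_coloring c, matches c (sl B j) b X,
      forall k, matches c (sr B k) b X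
    & forall k, k != j -> matches c (sl B k) b' X].

(** The Kempe (2,1)-chain turns the color 2 of both its ends into 1. The
swapped semiedges still match {1, 2, 3}: their end-vertices see the color 1 of
the chain, so their color set is {1, 2, 3} itself and not {2, 4, 5}, hence it
is aligned with {1, 2, 3} for every color. *)
Lemma right_superedge_adapted (B : superedge) (j : 'I_3) (sw : bool) :
  right_superedge B j ->
  exists c : coloring 5 (se_multipole B),
    adapted j c (if sw then col1 else col2) col3 [set col1; col2; col3].
Proof.
case=> c [nc cj cr cl ch].
set X := [set col1; col2; col3].
have mj : matches c (sl B j) col3 X.
  by apply: consistent_matches cj; apply/setP=> x; rewrite !inE orbC.
have mr k : matches c (sr B k) col3 X.
  by apply: consistent_matches (cr k); apply/setP=> x; rewrite !inE orbC.
have ml k : k != j -> matches c (sl B k) col2 X.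
  move=> kj; apply: consistent_matches (cl k kj).
  by apply/setP=> x; rewrite !inE orbA; congr (_ || _); rewrite orbC.
case: sw; last by exists c; split.
have [k [l [kj lj kl two]]] := other_two j.
have chkl := ch k l kj lj kl; have [propc _] := nc.
have chlk : kempe_chain c col2 col1 (sl B l) (sl B k).
  by apply: ch; rewrite // eq_sym.
have [c' [propc' colc' sk sl' sfix]] := kempe_swap_chain propc chkl.
have fix3 s Y : matches c s col3 Y -> matches c' s col3 Y.
  by move=> [s3 al]; split; [rewrite sfix ?s3|rewrite colc'].
have fullX m n : m != j -> kempe_chain c col2 col1 (sl B m) (sl B n) ->
    colors_at c (send (sl B m)) = X.
  move=> mj' chm; have [_ /orP[/eqP//|/eqP e]] := ml m mj'.
  by have := kempe_chain_colors_at (x := col1) chm isT; rewrite e !inE.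
exists c'; split=> //.
- split=> // u v uv; have [_ /(_ u v uv)] := nc.
  by rewrite /poor /rich !colc'.
- exact: fix3.
- by move=> m; apply: fix3.
- move=> m /two[->|->]; split.
  + by rewrite sk (ml k kj).1 tpermL.
  + by rewrite colc' (fullX k l) // aligned_refl.
  + by rewrite sl' (ml l lj).1 tpermL.
  + by rewrite colc' (fullX l k) // aligned_refl.
Qed.

(** Here a is meant to be the color of the third edge at a vertex of the cycle,
b' the color of the preceding and b that of the following cycle edge; sw tells
whether the supervertex is A'. *)
Lemma right_superedge_coloring (B : superedge) (j : 'I_3) (sw : bool) a b' b :
    right_superedge B j -> uniq [:: a; b'; b] ->
  exists c : coloring 5 (se_multipole B),
    adapted j c (if sw then a else b') b [set a; b'; b].
Proof.
move=> /(right_superedge_adapted sw)[c [nc mj mr ml]] u.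
have [//|p [p1 p2 p3]] := @perm_extending _ [:: col1; col2; col3] [:: a; b'; b] erefl _ u.
have -> : [set a; b'; b] = p @: [set col1; col2; col3].
  by rewrite !imsetU !imset_set1 p1 p2 p3.
exists (permute_colors c p); split; first exact: normal_permute.
- by rewrite -p3; apply: matches_permute.
- by move=> k; rewrite -p3; apply: matches_permute.
- move=> k kj; have := matches_permute p (ml k kj).
  by case: (sw); rewrite ?p1 ?p2.
Qed.

(** * The cycle *)

Section Cycle.
Variables (G : sgraph) (sigma : coloring 5 (graph_multipole G)).
Hypotheses (cubG : cubic (graph_multipole G)) (hsigma : normal_coloring sigma).
Variables (g : nat) (C : cycle_in G g).

Lemma cycle_adj_pred (i : 'I_g) : adj (C i) (C (ord_pred i)).
Proof. by rewrite adj_sym -{2}(ord_predK i) cyc_adj. Qed.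

(** Were g = 2, these two indices would agree. *)
Lemma ord_pred_neq_ordS (i : 'I_g) : ord_pred i != ordS i.
Proof.
have g2 := cyc_size C.
rewrite -(inj_eq (can_inj (@ordSK g))) ord_predK -val_eqE /=.
case: i => i ig /=; have [lt1|ge1] := ltnP i.+1 g.
  rewrite (modn_small lt1); have [lt2|ge2] := ltnP i.+2 g.
    by rewrite modn_small // -addn2 -{1}[i]addn0 eqn_add2l.
  have -> : i.+2 = g by apply/eqP; rewrite eqn_leq lt1 ge2.
  rewrite modnn; apply/eqP => i0; move: ge2; rewrite i0.
  by rewrite leqNgt g2.
have e : i.+1 = g by apply/eqP; rewrite eqn_leq ig ge1.
rewrite e modnn modn_small ?(ltn_trans _ g2) //.
by apply/eqP => i1; move: g2; rewrite -e i1.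
Qed.

(** The vertices of the cycle are distinct, so an edge of the cycle at u_i can
only be one of the two consecutive ones. This keeps the third edge at u_i in
the superposition even when it is a chord of the cycle. *)
Lemma cycle_edgeP (i : 'I_g) (w : G) :
  cycle_edge C (C i) w = (w == C (ord_pred i)) || (w == C (ordS i)).
Proof.
apply/existsP/orP => [[j /eqP/setP e]|[/eqP->|/eqP->]].
- have := e (C i); rewrite !inE eqxx /= => /esym/orP[/eqP/cyc_inj ij|].
    subst j; right; have := e (C (ordS i)).
    rewrite !inE eqxx orbT => /orP[/eqP eq|]; last by rewrite eq_sym.
    by have := cyc_adj C i; rewrite eq adj_irr.
  move=> /eqP/cyc_inj ij; left; rewrite ij ordSK.
  have := e (C j); rewrite !inE eqxx => /orP[/eqP eq|]; last by rewrite eq_sym.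
  by have := cyc_adj C j; rewrite -ij eq adj_irr.
- by exists (ord_pred i); rewrite ord_predK setUC.
- by exists i.
Qed.

Lemma third_neighbor (i : 'I_g) :
  exists v : G,
    [/\ v != C (ord_pred i), v != C (ordS i)
      & forall w, adj (C i) w =
          [|| w == C (ord_pred i), w == C (ordS i) | w == v]].
Proof.
pose A : {set G} := [set w | adj (C i) w].
have cA : #|A| = 3.
  rewrite -(cubG (C i : graph_multipole G)) -(card_imset A (@inl_inj G void)).
  apply: eq_card => -[w|[]] //=; rewrite /in_mem /=.
  rewrite -[LHS]/(inl w \in inl @: A) mem_imset; last exact: inl_inj.
  by rewrite inE.
have pA : C (ord_pred i) \in A by rewrite inE cycle_adj_pred.
have sA : C (ordS i) \in A :\ C (ord_pred i).
  by rewrite !inE cyc_adj (inj_eq (@cyc_inj _ _ C)) eq_sym ord_pred_neq_ordS.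
have : #|A :\ C (ord_pred i) :\ C (ordS i)| == 1.
  move: cA; rewrite (cardsD1 (C (ord_pred i))) pA.
  by rewrite (cardsD1 (C (ordS i))) sA !add1n => -[->].
case/cards1P=> v /setP e; exists v.
have := e v; rewrite !inE eqxx => /and3P[vs vp _]; split=> // w.
have := e w; rewrite !inE.
case: (eqVneq w (C (ordS i))) => [->|_] /=; first by rewrite cyc_adj orbT.
case: (eqVneq w (C (ord_pred i))) => [->|_] /=; first by rewrite cycle_adj_pred.
by [].
Qed.

Definition cycle_color (i : 'I_g) : 'I_5 := ecol sigma (C i) (C (ordS i)).

Lemma cycle_color_pred (i : 'I_g) :
  ecol sigma (C i) (C (ord_pred i)) = cycle_color (ord_pred i).
Proof. by rewrite /cycle_color ord_predK ecol_sym. Qed.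

Definition cycle_colors (i : 'I_g) : {set 'I_5} :=
  colors_at sigma (C i : graph_multipole G).

Lemma card_cycle_colors i : #|cycle_colors i| = 3.
Proof. by case: hsigma => propc _; apply: card_colors_at. Qed.

Lemma cycle_color_mem i : cycle_color i \in cycle_colors i.
Proof.
apply: (@mem_hcol _ _ sigma (C i : graph_multipole G) (inl (C (ordS i)))).
exact: cyc_adj.
Qed.

Lemma cycle_color_pred_mem i : cycle_color (ord_pred i) \in cycle_colors i.
Proof.
rewrite -cycle_color_pred.
apply: (@mem_hcol _ _ sigma (C i : graph_multipole G) (inl (C (ord_pred i)))).
exact: cycle_adj_pred.
Qed.

(** This is the normality of sigma on the cycle edge u_(i-1) u_i. *)
Lemma cycle_colors_aligned i :
  aligned (cycle_color (ord_pred i)) (cycle_colors (ord_pred i)) (cycle_colors i).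
Proof.
case: hsigma => _ /(_ (C (ord_pred i)) (C i)) nc.
apply: normal_sets_aligned; rewrite ?card_cycle_colors ?cycle_color_mem
  ?cycle_color_pred_mem //.
by apply: nc; rewrite adj_sym cycle_adj_pred.
Qed.

Lemma cycle_colorsE (v : G) i :
    v != C (ord_pred i) -> v != C (ordS i) ->
    (forall w, adj (C i) w = [|| w == C (ord_pred i), w == C (ordS i) | w == v]) ->
  uniq [:: ecol sigma (C i) v; cycle_color (ord_pred i); cycle_color i]
  /\ cycle_colors i =
       [set ecol sigma (C i) v; cycle_color (ord_pred i); cycle_color i].
Proof.
move=> vp vs vE; have [propc _] := hsigma.
have E : cycle_colors i =
    [set ecol sigma (C i) v; cycle_color (ord_pred i); cycle_color i].
  apply/setP=> x; rewrite !inE -orbA; apply/imsetP/or3P => [[[w|[]]]|].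
    rewrite {1}/in_mem /= vE => /or3P[]/eqP-> ->.
    + by constructor 2; rewrite /= cycle_color_pred.
    + by constructor 3.
    + by constructor 1.
  case=> /eqP->; first by exists (inl v); rewrite // /in_mem /= vE eqxx !orbT.
    exists (inl (C (ord_pred i))); first by rewrite /in_mem /= cycle_adj_pred.
    by rewrite /= cycle_color_pred.
  by exists (inl (C (ordS i))); rewrite // /in_mem /= cyc_adj.
split=> //; have c3 := card_cycle_colors i; move: c3; rewrite E => c3.
apply/card_uniqP; apply: (etrans _ c3); apply: eq_card => x.
by rewrite !inE orbA.
Qed.

End Cycle.

(** * The superposition *)

(** A vertex w inherits properness and its color set from a vertex v of another
multipole as soon as a color-preserving map psi sends the half-edges at v onto
those at w: such a map is one-to-one, since the colors at v are distinct. *)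
Lemma local_recoloring k (M N : multipole) (c : coloring k M)
    (d : coloring k N) (v : M) (w : N) (psi : M + semi M -> N + semi N) :
    {in incident v &, injective (hcol c v)} ->
    (forall h, incident v h ->
       incident w (psi h) /\ hcol d w (psi h) = hcol c v h) ->
    (forall h', incident w h' -> exists2 h, incident v h & psi h = h') ->
  {in incident w &, injective (hcol d w)} /\ colors_at d w = colors_at c v.
Proof.
move=> propc fw bw; split.
  move=> h1' h2' /bw[h1 vh1 <-] /bw[h2 vh2 <-].
  by rewrite (fw _ vh1).2 (fw _ vh2).2 => /(propc _ _ vh1 vh2)->.
apply/setP=> x; apply/imsetP/imsetP => -[h ih ->].
  by have [h0 vh0 <-] := bw h ih; exists h0; rewrite // (fw _ vh0).2.
by have [ih' <-] := fw h ih; exists (psi h).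
Qed.

Section Superposition.
Variables (G : sgraph) (sigma : coloring 5 (graph_multipole G)).
Hypotheses (cubG : cubic (graph_multipole G)) (hsigma : normal_coloring sigma).
Variables (g : nat) (C : cycle_in G g) (S : sp_data g).

Local Notation e := (cycle_color sigma C).
Local Notation T := (cycle_colors sigma C).
Local Notation pr := (@ord_pred g).

Variable v : 'I_g -> G.
Hypothesis vP : forall i,
  [/\ v i != C (pr i), v i != C (ordS i)
    & forall w, adj (C i) w = [|| w == C (pr i), w == C (ordS i) | w == v i]].

Local Notation f i := (ecol sigma (C i) (v i)).

Variable c : forall i, coloring 5 (se_multipole (spB S i)).
Hypothesis cP : forall i,
  adapted (dock S i) (c i) (if is_SvA' (spA S i) then f i else e (pr i)) (e i)
    (T i).

Local Notation N := (graph_multipole (superposition C S)).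

Definition old (u : G) : N := inl (inl u).
Definition sup (a : sup_vert S) : N := inl (inr a).
Definition new (n : new_vert S) : N := inr n.

(** Two adjacent vertices in different superedges are joined by a link at some
u_i, whose color is that of the cycle edge between u_(i-1) and u_i. *)
Definition sup_ecol (a b : sup_vert S) : 'I_5 :=
  if tag a == tag b then ecol (c (tag a)) (tagged a) (tagged_as a b)
  else ecol sigma (C (tag a)) (C (tag b)).

(** The first case is the edge towards B_i: there the Kempe swap has put f_i in
place of e_(i-1). *)
Definition new_ecol (n : new_vert S) (a : sup_vert S) : 'I_5 :=
  if tag a == (val n).1 then f (val n).1 else e (tag a).

(** Both dock edges of B_i have the color e_i, on its left as on its right, so
the color of an edge between u_j and B_i depends on i alone. *)
Definition sp_ecol (a b : N) : 'I_5 :=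
  match a, b with
  | inl (inl u), inl (inl w) => ecol sigma u w
  | inl (inr x), inl (inr y) => sup_ecol x y
  | inr m, inr n => if (val m).1 == (val n).1 then e (val m).1 else col1
  | inl (inl _), inl (inr x) | inl (inr x), inl (inl _) => e (tag x)
  | inr n, inl (inr x) | inl (inr x), inr n => new_ecol n x
  | inl (inl _), inr _ | inr _, inl (inl _) => col1
  end.

Lemma sp_ecol_sym a b : sp_ecol a b = sp_ecol b a.
Proof.
case: a b => [[u|x]|m] [[w|y]|n] //=; first exact: ecol_sym.
  rewrite /sup_ecol; case: x y => [i x] [j y] /=; rewrite [j == i]eq_sym.
  case: eqVneq => [ij|_]; last exact: ecol_sym.
  by subst j; rewrite !tagged_asE ecol_sym.
by rewrite [(val n).1 == _]eq_sym; case: eqVneq => // ->.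
Qed.

Definition sp_coloring : coloring 5 N :=
  @Coloring 5 N sp_ecol (fun s => match s with end) sp_ecol_sym.

Lemma pr_neq i : pr i != i.
Proof. exact/ord_pred_neq/ltnW/(cyc_size C). Qed.

Lemma prev_end_ordS i k : prev_end S (ordS i) (spp S i k) = right_end S i k.
Proof. by rewrite /prev_end ordSK permK. Qed.

(** The j-th link at u_i runs from [prev_end S i j] to [left_end S i j];
[across_left i j] is the neighbor of the latter on the link, [across_right i j]
that of the former. They agree when the link is subdivided. *)
Definition across_left (i : 'I_g) (j : 'I_3) : N :=
  if j == dock S i then old (C i)
  else if insub (i, j) is Some n then new n else sup (prev_end S i j).

Definition across_right (i : 'I_g) (j : 'I_3) : N :=
  if j == dock S i then old (C i)
  else if insub (i, j) is Some n then new n else sup (left_end S i j).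

(** The shape of a link decides what its two ends see on it, so one case
analysis serves both ends. *)
Variant link_spec i j : N -> N -> Prop :=
| DockLink of j = dock S i : link_spec i j (old (C i)) (old (C i))
| NewLink (n : new_vert S) of j != dock S i & is_SvA' (spA S i) & val n = (i, j) :
   link_spec i j (new n) (new n)
| PlainLink of j != dock S i & ~~ is_SvA' (spA S i) :
   link_spec i j (sup (prev_end S i j)) (sup (left_end S i j)).

Lemma linkP i j : link_spec i j (across_left i j) (across_right i j).
Proof.
rewrite /across_left /across_right; case: eqVneq => [jd|jd].
  exact: DockLink.
case: insubP => [n nP nE|].
  by move: nP; rewrite /new_index => /andP[/= sA _]; apply: NewLink.
rewrite /new_index /= jd andbT => sA; exact: PlainLink.
Qed.

Lemma across_left_adj i j : adj (sup (left_end S i j)) (across_left i j).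
Proof.
case: linkP => [->|n jd sA nE|jd sA] /=.
- by apply/existsP; exists i; rewrite !eqxx orbT.
- by rewrite /new_adj nE !eqxx orbT.
- apply/orP; right; apply/existsP; exists i; apply/existsP; exists j.
  by rewrite jd sA !eqxx.
Qed.

Lemma across_right_adj i j : adj (sup (prev_end S i j)) (across_right i j).
Proof.
case: linkP => [->|n jd sA nE|jd sA] /=.
- by apply/existsP; exists i; rewrite !eqxx.
- by rewrite /new_adj nE !eqxx.
- apply/orP; left; apply/orP; right; apply/existsP; exists i.
  by apply/existsP; exists j; rewrite jd sA !eqxx.
Qed.

Lemma across_left_color i j :
  ecol sp_coloring (sup (left_end S i j)) (across_left i j) = scol (c i) (sl _ j).
Proof.
have [_ mj _ ml] := cP i.
case: linkP => [->|n jd sA nE|jd sA] /=; first by rewrite mj.1.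
  by rewrite /new_ecol nE /= eqxx (ml j jd).1 sA.
rewrite /sup_ecol /= eq_sym (negbTE (pr_neq i)) cycle_color_pred.
by rewrite (ml j jd).1 (negbTE sA).
Qed.

Lemma across_right_color i j :
  ecol sp_coloring (sup (prev_end S i j)) (across_right i j) = e (pr i).
Proof.
case: linkP => [->|n jd sA nE|jd sA] //=.
  by rewrite /new_ecol nE /= (negbTE (pr_neq i)).
by rewrite /sup_ecol /= (negbTE (pr_neq i)) /cycle_color ord_predK.
Qed.

Lemma across_prev_end i j :
  across_right (ordS (pr i)) (spp S (pr i) ((spp S (pr i))^-1%g j))
    = across_right i j.
Proof. by rewrite ord_predK permKV. Qed.

(** Every neighbor of a vertex of a superedge lies in this superedge or at the
other end of a link: this reduces adjacency to the half-edges of B_i. *)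
Lemma sup_adjP (a : sup_vert S) (b : N) : adj (sup a) b ->
  [\/ exists2 y : kept_graph (spB S (tag a)),
        adj (tagged a) y &
          b = sup (Tagged (fun i => kept_graph (spB S i)) y),
      exists i j, a = left_end S i j /\ b = across_left i j
    | exists i j, a = prev_end S i j /\ b = across_right i j].
Proof.
case: b => [[u|y]|n].
- case/existsP=> i /andP[/eqP-> /orP[]/eqP->].
    constructor 3; exists i, (dock S i); split=> //.
    by rewrite /across_right eqxx.
  constructor 2; exists i, (dock S i); split=> //.
  by rewrite /across_left eqxx.
- rewrite /= /sup_adj => /orP[/orP[/andP[]|]|].
  + case: a y => [i x] [j y] /= /eqP ij; subst j; rewrite tagged_asE => xy.
    by constructor 1; exists y.
  + case/existsP=> i /existsP[j /and4P[jd sA /eqP-> /eqP->]].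
    constructor 3; exists i, j; split=> //.
    case: linkP => [jd'|n _ sA' _|//]; first by rewrite jd' eqxx in jd.
    by rewrite sA' in sA.
  + case/existsP=> i /existsP[j /and4P[jd sA /eqP-> /eqP->]].
    constructor 2; exists i, j; split=> //.
    case: linkP => [jd'|n _ sA' _|//]; first by rewrite jd' eqxx in jd.
    by rewrite sA' in sA.
- rewrite /= /new_adj; case nE: (val n) => [i j].
  have := valP n; rewrite nE /new_index /= => /andP[sA jd].
  have En n' : val n' = (i, j) -> new n' = new n.
    by move=> n'E; congr new; apply: val_inj; rewrite nE.
  case/orP=> /eqP->.
    constructor 3; exists i, j; split=> //.
    case: linkP => [jd'|n' _ _ /En//|_]; first by rewrite jd' eqxx in jd.
    by rewrite sA.
  constructor 2; exists i, j; split=> //.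
  case: linkP => [jd'|n' _ _ /En//|_]; first by rewrite jd' eqxx in jd.
  by rewrite sA.
Qed.

Definition proper_with (a : N) (X : {set 'I_5}) : Prop :=
  {in incident a &, injective (hcol sp_coloring a)} /\ colors_at sp_coloring a = X.

(** The model is the same vertex in the multipole B_i. *)
Lemma proper_sup (a : sup_vert S) :
  proper_with (sup a) (colors_at (c (tag a)) (tagged a)).
Proof.
case: a => i x; have [[propc _] _ mr _] := cP i.
pose psi (h : se_multipole (spB S i) + semi (se_multipole (spB S i))) :
    N + semi N :=
  match h with
  | inl y => inl (sup (Tagged (fun i => kept_graph (spB S i)) y))
  | inr (inl j) => inl (across_left i j)
  | inr (inr k) => inl (across_right (ordS i) (spp S i k))
  end.
apply: (local_recoloring (psi := psi) (propc x)).
  move=> [y|[j|k]] /=.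
  - by rewrite /sup_adj /sup_ecol /= eqxx tagged_asE => ->.
  - by move/eqP<-; split; [apply: across_left_adj|apply: across_left_color].
  - have ad := across_right_adj (ordS i) (spp S i k).
    have col := across_right_color (ordS i) (spp S i k).
    rewrite prev_end_ordS in ad col; rewrite ordSK -(mr k).1 in col.
    by move/eqP<-; split; [exact: ad|exact: col].
move=> [b|[]] /sup_adjP[[y xy ->]|[i' [j [ai ->]]]|[i' [j [ai ->]]]].
- by exists (inl y).
- have ii : i = i' by have := congr1 tag ai.
  subst i'; exists (inr (inl j)) => //=.
  have := congr1 (fun a => tagged_as (left_end S i j) a) ai.
  by rewrite !tagged_asE => ->.
- have ii : i = pr i' by have := congr1 tag ai.
  subst i; exists (inr (inr ((spp S (pr i'))^-1%g j))) => /=.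
    have := congr1 (fun a => tagged_as (prev_end S i' j) a) ai.
    by rewrite !tagged_asE => ->.
  by rewrite across_prev_end.
Qed.

Lemma cycle_vertex_adj i w :
  adj (C i) w && ~~ cycle_edge C (C i) w = (w == v i).
Proof.
have [vp vs vE] := vP i; rewrite vE cycle_edgeP //.
case: (eqVneq w (C (pr i))) vp => [->|_ _]; first by rewrite eq_sym => /negbTE->.
case: (eqVneq w (C (ordS i))) vs => [->|_ _]; first by rewrite eq_sym => /negbTE->.
by rewrite andbT.
Qed.

(** The model is u_i in G: the ends of the two dock edges take the place of the
neighbors of u_i on the cycle. *)
Lemma proper_cycle_vertex i : proper_with (old (C i)) (T i).
Proof.
have [propc _] := hsigma; have [vp vs vE] := vP i.
pose psi (h : graph_multipole G + semi (graph_multipole G)) : N + semi N :=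
  match h with
  | inl w => inl (if w == C (pr i) then sup (prev_end S i (dock S i))
                  else if w == C (ordS i) then sup (left_end S i (dock S i))
                  else old w)
  | inr s => inr s
  end.
have sp : (C (ordS i) == C (pr i)) = false.
  by rewrite (inj_eq (@cyc_inj _ _ C)) eq_sym (negbTE (ord_pred_neq_ordS C i)).
apply: (local_recoloring (psi := psi) (propc (C i))).
  move=> [w|[]] /=; rewrite vE => /or3P[]/eqP->.
  - rewrite eqxx cycle_color_pred; split=> //.
    by apply/existsP; exists i; rewrite !eqxx.
  - rewrite sp eqxx; split=> //.
    by apply/existsP; exists i; rewrite !eqxx orbT.
  - by rewrite (negbTE vp) (negbTE vs) /= cycle_vertex_adj.
move=> [[[w|x]|n]|[]] //=.
  rewrite /= cycle_vertex_adj => /eqP->; exists (inl (v i)).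
    by rewrite /= vE eqxx !orbT.
  by rewrite /= (negbTE vp) (negbTE vs).
case/existsP=> i' /andP[/eqP/cyc_inj <- /orP[]/eqP->].
- by exists (inl (C (pr i))); rewrite /= ?eqxx // cycle_adj_pred.
- by exists (inl (C (ordS i))); rewrite /= ?sp ?eqxx // cyc_adj.
Qed.

Lemma proper_old u : proper_with (old u) (colors_at sigma (u : graph_multipole G)).
Proof.
case: (pickP (fun i => C i == u)) => [i /eqP<-|Cu].
  exact: proper_cycle_vertex.
have nC i : u != C i by rewrite eq_sym Cu.
have [propc _] := hsigma.
pose psi (h : graph_multipole G + semi (graph_multipole G)) : N + semi N :=
  match h with inl w => inl (old w) | inr s => inr s end.
have nE w : cycle_edge C u w = false.
  apply/existsP=> -[i /eqP/setP/(_ u)]; rewrite !inE eqxx /=.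
  by rewrite !(negbTE (nC _)).
apply: (local_recoloring (psi := psi) (propc u)).
  by move=> [w|[]] /= uw; rewrite nE uw.
move=> [[[w|x]|n]|[]] //=; first by rewrite nE andbT => uw; exists (inl w).
by case/existsP=> i; rewrite (negbTE (nC i)).
Qed.

Lemma new_partner (n : new_vert S) :
  exists m : new_vert S, [/\ (val m).1 = (val n).1, m != n
    & forall m', (val m').1 = (val n).1 -> m' != n -> m' = m].
Proof.
case nE: (val n) => [i j]; rewrite [(i, j).1]/=; have := valP n.
rewrite nE /new_index /= => /andP[sA jd].
have [k [l [kd ld kl two]]] := other_two (dock S i).
have [k' [kd' kj two']] : exists k', [/\ k' != dock S i, k' != j
    & forall m, m != dock S i -> m != j -> m = k'].
  case/two: (jd) => ->; [exists l|exists k]; split; rewrite // 1?eq_sym //.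
    by move=> m /two[->|->]; rewrite ?eqxx.
  by move=> m /two[->|->]; rewrite ?eqxx.
have mP : new_index S (i, k') by rewrite /new_index /= sA.
exists (Sub (i, k') mP); rewrite SubK; split=> //.
  by rewrite -val_eqE SubK nE; apply: contraNneq kj => -[->].
case=> [[i' j'] m'P] /= ii; subst i'.
rewrite -val_eqE nE /= xpair_eqE eqxx => j'j; apply: val_inj => /=.
by case/andP: (m'P) => _ j'd; rewrite (two' j').
Qed.

(** The model is again u_i in G, in another arrangement: the end in B_(i-1)
keeps the color e_(i-1), the partner vertex gets e_i and the end in B_i gets
f_i. *)
Lemma proper_new n : proper_with (new n) (T (val n).1).
Proof.
have [m [mi mn mE]] := new_partner n.
case nE: (val n) mi mE => [i j] /= mi mE.
have [propc _] := hsigma; have [vp vs vE] := vP i.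
have sp : (C (ordS i) == C (pr i)) = false.
  by rewrite (inj_eq (@cyc_inj _ _ C)) eq_sym (negbTE (ord_pred_neq_ordS C i)).
pose psi (h : graph_multipole G + semi (graph_multipole G)) : N + semi N :=
  match h with
  | inl w => inl (if w == C (pr i) then sup (prev_end S i j)
                  else if w == C (ordS i) then new m
                  else sup (left_end S i j))
  | inr s => inr s
  end.
apply: (local_recoloring (psi := psi) (propc (C i))).
  move=> [w|[]] /=; rewrite vE => /or3P[]/eqP->.
  - rewrite eqxx cycle_color_pred /= /new_adj /new_ecol nE /= !eqxx.
    by rewrite (negbTE (pr_neq i)).
  - by rewrite sp eqxx /= nE mi eqxx eq_sym mn.
  - rewrite (negbTE vp) (negbTE vs) /= /new_adj /new_ecol nE /= !eqxx.
    by rewrite orbT.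
move=> [[[w|x]|m']|[]] //=.
  rewrite /new_adj nE => /orP[]/eqP->.
    by exists (inl (C (pr i))); rewrite /= ?eqxx // cycle_adj_pred.
  exists (inl (v i)); first by rewrite /= vE eqxx !orbT.
  by rewrite /= (negbTE vp) (negbTE vs).
rewrite nE /= eq_sym [n == _]eq_sym => /andP[/eqP m'i m'n].
exists (inl (C (ordS i))); first exact: cyc_adj.
by rewrite /= sp eqxx (mE m').
Qed.

(** The coloring of B_(i-1) aligns its right ends with T_(i-1); the normality
of sigma moves them on to T_i. *)
Lemma aligned_prev_end i j :
  aligned (e (pr i)) (colors_at sp_coloring (sup (prev_end S i j))) (T i).
Proof.
rewrite (proper_sup _).2; have [_ _ mr _] := cP (pr i).
have [_ al] := mr ((spp S (pr i))^-1%g j).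
apply: (aligned_trans (cycle_color_pred_mem _ _ _) al).
exact: cycle_colors_aligned.
Qed.

Lemma scol_left_mem i j : scol (c i) (sl _ j) \in T i.
Proof.
have [_ mj _ ml] := cP i; have [vp vs vE] := vP i.
case: (eqVneq j (dock S i)) => [->|jd]; first by rewrite mj.1 cycle_color_mem.
rewrite (ml j jd).1 (cycle_colorsE cubG hsigma vp vs vE).2.
by case: ifP; rewrite !inE eqxx ?orbT.
Qed.

Lemma aligned_left_end i j :
  aligned (scol (c i) (sl _ j)) (colors_at sp_coloring (sup (left_end S i j))) (T i).
Proof.
rewrite (proper_sup _).2; have [_ mj _ ml] := cP i.
case: (eqVneq j (dock S i)) => [->|jd].
  by case: mj => -> al.
by case: (ml j jd) => -> al.
Qed.

Lemma aligned_across_left i j :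
  aligned (scol (c i) (sl _ j)) (colors_at sp_coloring (across_left i j)) (T i).
Proof.
have [_ _ _ ml] := cP i.
case: linkP => [_|n _ _ nE|jd sA].
- by rewrite (proper_cycle_vertex i).2 aligned_refl.
- by rewrite (proper_new n).2 nE aligned_refl.
- by rewrite (ml j jd).1 (negbTE sA) aligned_prev_end.
Qed.

Lemma aligned_across_right i j :
  aligned (e (pr i)) (colors_at sp_coloring (across_right i j)) (T i).
Proof.
have [_ _ _ ml] := cP i.
case: linkP => [_|n _ _ nE|jd sA].
- by rewrite (proper_cycle_vertex i).2 aligned_refl.
- by rewrite (proper_new n).2 nE aligned_refl.
- by have := aligned_left_end i j; rewrite (ml j jd).1 (negbTE sA).
Qed.

Lemma normal_at_sup (a : sup_vert S) (b : N) :
  adj (sup a) b -> normal_sets (colors_at sp_coloring (sup a)) (colors_at sp_coloring b).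
Proof.
have cT i : #|T i| = 3 by apply: card_cycle_colors.
case/sup_adjP=> [[y ay ->]|[i [j [-> ->]]]|[i [j [-> ->]]]].
- rewrite !(proper_sup _).2 /=; have [[_ nc] _ _ _] := cP (tag a).
  exact: nc ay.
- apply: (common_aligned_normal_sets (cT i) (scol_left_mem i j)).
    exact: aligned_left_end.
  exact: aligned_across_left.
- apply: (common_aligned_normal_sets (cT i) (cycle_color_pred_mem sigma C i)).
    exact: aligned_prev_end.
  exact: aligned_across_right.
Qed.

Lemma normal_sp_coloring : normal_coloring sp_coloring.
Proof.
split.
  case=> [[u|a]|n]; first exact: (proper_old u).1.
    exact: (proper_sup a).1.
  exact: (proper_new n).1.
move=> [[u|a]|n] b; last 2 first.
- exact: normal_at_sup.
- case: b => [[w|b]|m] //.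
    rewrite /= => nb; rewrite -[_ || _]/(normal_sets _ _) normal_setsC.
    exact: (@normal_at_sup b (new n)).
  case/andP=> /eqP nm _; apply/orP; left.
  rewrite /poor (proper_new n).2 (proper_new m).2 nm setUid.
  by rewrite card_cycle_colors.
case: b => [[w|b]|m] //.
  case/andP=> uw _; have [_ /(_ u w uw)] := hsigma.
  by rewrite /poor /rich (proper_old u).2 (proper_old w).2.
rewrite /= => nb; rewrite -[_ || _]/(normal_sets _ _) normal_setsC.
exact: (@normal_at_sup b (old u)).
Qed.

End Superposition.

Theorem theorem10 (G : sgraph) (hG : snark G)
  (sigma : coloring 5 (graph_multipole G)) (hsigma : normal_coloring sigma)
  (g : nat) (C : cycle_in G g) (S : sp_data g)
  (hS : forall i : 'I_g, dock_right S i) :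
  exists tau : coloring 5 (graph_multipole (superposition C S)), normal_coloring tau.
Proof.
have [cubG _ _] := hG.
have [v vP] := fin_all_exists (third_neighbor cubG C).
pose e := cycle_color sigma C; pose f i := ecol sigma (C i) (v i).
have cE i : exists c : coloring 5 (se_multipole (spB S i)),
    adapted (dock S i) c (if is_SvA' (spA S i) then f i else e (ord_pred i))
      (e i) (cycle_colors sigma C i).
  have [vp vs vE] := vP i.
  have [u ->] := cycle_colorsE cubG hsigma vp vs vE.
  exact: (right_superedge_coloring (is_SvA' (spA S i)) (hS i) u).
have [c cP] := fin_all_exists cE.
by exists (sp_coloring sigma C v c); exact: (normal_sp_coloring cubG hsigma vP cP).
Qed.
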